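(* Let $a,b\in\mathbb{Z}$ with $a<b$, let $n>1$ be an integer, and let $f$ be a real function that is $C^n$ on $[a,b]$. Let $m,p\ge 0$ be integers with $m\le b-a$, put $a'=a+m$, and let $$R_{mnp}=(-1)^{n}\int_{a'}^{b}\sum_{|k|>p}\frac{e^{2\pi i kx}}{(2\pi i k)^{n}}\,f^{(n)}(x)\,dx.$$ Then: 1. $|R_{mnp}|\le T_{n,p}\int_{a'}^{b}|f^{(n)}(x)|\,dx.$ 2. If $n$ is odd and $f^{(n)}$ is monotone on $[a',b]$, then $|R_{mnp}|\le 2\,T_{n+1,p}\,|M_n(a',b)|$. If $n$ is even and $f^{(n)}$ is monotone on $[a',b]$, then $|R_{mnp}|\le T_{n+1,p}\,|M_n(a',b)|$.
   Context: For integers $s\ge 2$ and $p\ge 0$, $T_{s,p}=\frac{2}{(2\pi)^{s}}\left(\zeta(s)-\sum_{k=1}^{p}\frac{1}{k^{s}}\right)$, where $\zeta$ is the Riemann zeta function. For an integer $\nu\ge 0$, $M_\nu(a',b)=f^{(\nu)}(a')-f^{(\nu)}(b)$. In the exponentials $i$ is the imaginary unit, and the sum over $|k|>p$ runs over $k\in\mathbb{Z}$. *)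

(* Defs.v *)
From Stdlib Require Import Reals ZArith.
From Coquelicot Require Import Coquelicot.

Open Scope R_scope.

(* [iota P] is the unique element satisfying [P]; its value is unspecified when
   there is none.  It is used below as a total "the limit of ..." operator, in
   the same way as in Coquelicot's own [RInt]. *)

(** * Functions of class C^n on a closed interval *)

Definition Icc (a b : R) : R -> Prop := fun x => a <= x <= b.

(* Derivative relative to [a, b]: the point [y] of the difference quotient stays
   in [a, b], so the derivative is one-sided at the end points and the values of
   [f] outside [a, b] play no role. *)
Definition is_derive_on (a b : R) (f : R -> R) (x l : R) : Prop :=
  filterlim (fun y => (f y - f x) / (y - x))
    (within (Icc a b) (locally' x)) (locally l).

Definition Derive_on (a b : R) (f : R -> R) (x : R) : R :=
  iota (fun l : R => is_derive_on a b f x l).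

Fixpoint Derive_n_on (a b : R) (f : R -> R) (n : nat) : R -> R :=
  match n with
  | O => f
  | S k => Derive_on a b (Derive_n_on a b f k)
  end.

Definition C_n_on (a b : R) (n : nat) (f : R -> R) : Prop :=
  (forall k : nat, (k < n)%nat -> forall x : R, Icc a b x ->
     exists l : R, is_derive_on a b (Derive_n_on a b f k) x l) /\
  continuous_on (Icc a b) (Derive_n_on a b f n).

Definition monotone_on (a b : R) (g : R -> R) : Prop :=
  (forall x y : R, a <= x -> x <= y -> y <= b -> g x <= g y) \/
  (forall x y : R, a <= x -> x <= y -> y <= b -> g y <= g x).

(** * The constants [T_{s,p}] *)

(* Only meaningful for [2 <= s]; [Series] is indexed from 0. *)
Definition zeta (s : nat) : R := Series (fun k : nat => / INR (S k) ^ s).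

Definition T (s p : nat) : R :=
  2 / (2 * PI) ^ s * (zeta s - sum_n_m (fun k : nat => / INR k ^ s) 1 p).

(** * The remainder term *)

Definition Cexp (z : C) : C :=
  (exp (Re z) * cos (Im z), exp (Re z) * sin (Im z)).

(* The sum of [u k] over the integers [k] with [|k| > p], as the limit of the
   sums over [p < |k| <= N] when [N] tends to infinity.  The families it is
   applied to below are absolutely summable, so the order is immaterial. *)
Definition sum_Z_gt (p : nat) (u : Z -> C) : C :=
  iota (T := C_R_CompleteNormedModule) (fun l : C =>
    filterlim
      (fun N : nat =>
         sum_n_m (fun k : nat => (u (Z.of_nat k) + u (- Z.of_nat k)%Z)%C) (S p) N)
      eventually (locally l)).

Definition two_pi_i_k (k : Z) : C := (RtoC (2 * PI) * Ci * RtoC (IZR k))%C.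

(* The integral is that of a complex-valued function of a real variable;
   [g] is the n-th derivative of the function of interest. *)
Definition remainder (a' b : R) (n p : nat) (g : R -> R) : C :=
  (RtoC ((-1) ^ n) *
   RInt (V := C_R_CompleteNormedModule)
     (fun x : R =>
        sum_Z_gt p (fun k : Z =>
          Cexp (two_pi_i_k k * RtoC x) / two_pi_i_k k ^ n) * RtoC (g x))
     a' b)%C.

(* Main.v *)
Require Import Defs.
From Stdlib Require Import Reals ZArith Lra Lia.
From Coquelicot Require Import Coquelicot.

Open Scope R_scope.

(* Pairing [k] with [-k] turns the kernel into a unit complex constant times
   [phi x = sum_(k > p) 2 h(2 pi k x) / (2 pi k)^n], where [h] is [cos] for even
   [n] and [sin] for odd [n]; so [|phi| <= T n p], which is the first bound.
   Integrating termwise gives a primitive [Phi] of [phi] that vanishes at the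
   integers and is bounded by [D * T (n + 1) p], where [D = 1] comes from [sin]
   and [D = 2] from [1 - cos].  For monotone [g], the integral of [phi * g] over
   an interval with [Phi = 0] at both ends is a Stieltjes integral
   [- int Phi dg], hence at most [sup |Phi|] times the variation of [g].  The
   estimates are made for the partial sums, which converge uniformly. *)

(** * Convergence of the zeta series and [T] as a tail sum *)

(** Comparison with exponent 2, whose increasing partial sums are bounded by a telescoping
    estimate. *)
Lemma ex_series_inv_pow (s : nat) :
  (2 <= s)%nat -> ex_series (fun k : nat => / INR (S k) ^ s).
Proof.
  intros Hs.
  assert (Hpos : forall k, 0 < INR (S k)) by (intros k; apply lt_0_INR; lia).
  apply (ex_series_le (V := R_CompleteNormedModule) _
           (fun k : nat => / INR (S k) ^ 2)).
  { intros k. unfold norm; simpl norm.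
    change (Rabs (/ INR (S k) ^ s) <= / INR (S k) ^ 2).
    rewrite Rabs_pos_eq
      by (apply Rlt_le, Rinv_0_lt_compat, pow_lt, Hpos).
    apply Rinv_le_contravar; [apply pow_lt, Hpos|].
    apply Rle_pow; [|exact Hs].
    rewrite S_INR; generalize (pos_INR k); lra. }
  destruct (ex_finite_lim_seq_incr (sum_n (fun k : nat => / INR (S k) ^ 2)) 2)
    as [l Hl].
  - intros N. rewrite sum_Sn.
    assert (0 < / INR (S (S N)) ^ 2) by (apply Rinv_0_lt_compat, pow_lt, Hpos).
    unfold plus; simpl; simpl in *; lra.
  - intros N.
    (* The bound 2 alone is not inductive; the sharper [2 - / INR (S N)] is, because
       [1 / (y + 1)^2 <= 1 / y - 1 / (y + 1)]. *)
    apply Rle_trans with (2 - / INR (S N)).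
    + induction N as [|N IH].
      * rewrite sum_O; simpl; lra.
      * rewrite sum_Sn; unfold plus; simpl plus.
        assert (/ INR (S (S N)) ^ 2 <= / INR (S N) - / INR (S (S N))).
        { generalize (Hpos N); intros HN. rewrite (S_INR (S N)).
          set (y := INR (S N)) in *.
          apply Rminus_le.
          replace (_ - _) with (- / (y * (y + 1) ^ 2)) by (field; lra).
          assert (0 < / (y * (y + 1) ^ 2)); [|lra].
          apply Rinv_0_lt_compat, Rmult_lt_0_compat; [lra|apply pow_lt; lra]. }
        change (sum_n (fun k : nat => / INR (S k) ^ 2) N + / INR (S (S N)) ^ 2
                <= 2 - / INR (S (S N))).
        lra.
    + assert (0 < / INR (S N)) by (apply Rinv_0_lt_compat, Hpos). lra.
  - exists l. exact Hl.
Qed.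

(* Twice [/ (2 * PI * k) ^ s]: the terms [k] and [-k] together. *)
Definition coef (s k : nat) : R := 2 / (2 * PI * INR k) ^ s.

(** Removing the first [p] terms of [zeta] leaves the sum over [k > p], and the factor
    [2 / (2 * PI) ^ s] goes into each term. *)
Lemma is_lim_seq_T (s p : nat) :
  (2 <= s)%nat -> is_lim_seq (fun N => sum_n_m (coef s) (S p) N) (T s p).
Proof.
  intros Hs. unfold T.
  apply is_lim_seq_ext_loc with
    (fun N => 2 / (2 * PI) ^ s *
       (sum_n (fun k : nat => / INR (S k) ^ s) (pred N)
        - sum_n_m (fun k : nat => / INR k ^ s) 1 p)).
  (* The sum up to [N] can be split at [p] once [N > p]; [pred N] accounts for [zeta] being indexed
     from 0. *)
  - exists (S p); intros N HN.
    transitivity (2 / (2 * PI) ^ s *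
                  sum_n_m (fun k : nat => / INR k ^ s) (S p) N).
    + f_equal. unfold sum_n. rewrite (sum_n_m_S (fun k => / INR k ^ s)).
      replace (S (pred N)) with N by lia.
      rewrite (sum_n_m_Chasles _ 1 p N) by lia.
      unfold plus; simpl; ring.
    + rewrite <- (sum_n_m_mult_l (K := R_Ring)).
      apply sum_n_m_ext_loc. intros k Hk. unfold coef, mult; simpl mult.
      assert (0 < INR k) by (apply lt_0_INR; lia).
      generalize PI_RGT_0; intros HPI.
      change (2 / (2 * PI) ^ s * / INR k ^ s = 2 / (2 * PI * INR k) ^ s).
      rewrite (Rpow_mult_distr (2 * PI)).
      field; split; apply pow_nonzero; lra.
  - apply (is_lim_seq_scal_l _ _ (Finite _)).
    apply is_lim_seq_minus'; [|apply is_lim_seq_const].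
    apply is_lim_seq_incr_1. simpl.
    exact (Series_correct _ (ex_series_inv_pow s Hs)).
Qed.

Lemma coef_nonneg (s k : nat) : (0 < k)%nat -> 0 <= coef s k.
Proof.
  intros Hk. apply Rlt_le, Rdiv_lt_0_compat; [lra|].
  apply pow_lt, Rmult_lt_0_compat; [generalize PI_RGT_0; lra|].
  now apply lt_0_INR.
Qed.

(** * The Weierstrass M-test with explicit tail bounds *)

Section Mtest.

Variables (u : nat -> R -> R) (c : nat -> R) (p : nat) (L : R).
Hypothesis u_le : forall k x, (p < k)%nat -> Rabs (u k x) <= c k.
Hypothesis lim_c : is_lim_seq (fun N => sum_n_m c (S p) N) L.

Let A (N : nat) : R := sum_n_m c (S p) N.
Let U (x : R) (N : nat) : R := sum_n_m (fun k => u k x) (S p) N.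

Lemma Mtest_partial (x : R) (N M : nat) :
  (N <= M)%nat -> Rabs (U x M - U x N) <= A M - A N.
Proof.
  induction 1 as [|M HNM IH].
  - rewrite !Rminus_diag, Rabs_R0; lra.
  - unfold U, A in *. destruct (Nat.le_gt_cases p M) as [Hp|Hp].
    + rewrite !(sum_n_Sm _ (S p) M) by lia. unfold plus; simpl plus.
      generalize (u_le (S M) x ltac:(lia)); intros HM.
      revert IH HM. generalize (sum_n_m (fun k => u k x) (S p) M)
        (sum_n_m (fun k => u k x) (S p) N) (sum_n_m c (S p) M)
        (sum_n_m c (S p) N) (u (S M) x) (c (S M)).
      intros r1 r2 r3 r4 r5 r6.
      intros IH HM.
      change (Rabs ((r1 + r5) - r2) <= (r3 + r6) - r4).
      replace (r1 + r5 - r2) with ((r1 - r2) + r5) by ring.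
      eapply Rle_trans; [apply Rabs_triang|lra].
    + rewrite !(sum_n_m_zero _ (S p) (S M)) by lia.
      rewrite !(sum_n_m_zero _ (S p) N) by lia.
      rewrite !Rminus_diag, Rabs_R0; lra.
Qed.

(** The increments of [A] dominate absolute values, so [A] is nondecreasing beyond [M] and [A M] is
    at most its limit [L]. *)
Lemma Mtest_tail (x : R) (N M : nat) :
  (N <= M)%nat -> Rabs (U x M - U x N) <= L - A N.
Proof.
  intros HNM. apply Rle_trans with (1 := Mtest_partial x N M HNM).
  apply Rplus_le_compat_r.
  apply (is_lim_seq_le_loc (fun _ => A M) A (A M) L);
    [|apply is_lim_seq_const|exact lim_c].
  exists M; intros K HK.
  generalize (Mtest_partial x M K HK) (Rabs_pos (U x K - U x M)); lra.
Qed.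

(** This is the tail bound measured from index 0, where both sums are empty because they start at
    [S p]. *)
Lemma Mtest_bound (x : R) (N : nat) : Rabs (U x N) <= L.
Proof.
  generalize (Mtest_tail x 0 (max N 0) ltac:(lia)).
  unfold U, A. rewrite !(sum_n_m_zero _ (S p) 0) by lia.
  rewrite Nat.max_0_r. unfold zero; simpl; rewrite !Rminus_0_r; easy.
Qed.

(** The partial sums are Cauchy at each [x]; the error bound is free of [x], so convergence is
    uniform on the whole line. *)
Lemma Mtest :
  exists v : R -> R,
    (forall x, is_lim_seq (fun N => sum_n_m (fun k => u k x) (S p) N) (v x)) /\
    (forall x N, Rabs (v x - sum_n_m (fun k => u k x) (S p) N)
 <= L - sum_n_m c (S p) N).
Proof.
  assert (Hsmall : forall eps : posreal, exists N, L - A N < eps).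
  { intros eps. apply is_lim_seq_spec in lim_c.
    destruct (lim_c eps) as [N HN]; exists N.
    specialize (HN N (Nat.le_refl N)). apply Rabs_def2 in HN.
    change (A N - L < eps /\ - eps < A N - L) in HN. lra. }
  assert (Hcv : forall x, is_lim_seq (U x) (real (Lim_seq (U x)))).
  { intros x. apply Lim_seq_correct', ex_lim_seq_cauchy_corr.
    intros eps. destruct (Hsmall (pos_div_2 eps)) as [N HN].
    exists N; intros j k Hj Hk.
    generalize (Mtest_tail x N j Hj) (Mtest_tail x N k Hk).
    simpl in HN. unfold Rabs; repeat destruct Rcase_abs; lra. }
  exists (fun x => real (Lim_seq (U x))).
  split; [exact Hcv|].
  assert (Hb : forall x N, Rabs (real (Lim_seq (U x)) - U x N) <= L - A N).
  { intros x N.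
    apply (is_lim_seq_le_loc (fun M => Rabs (U x M - U x N)) (fun _ => L - A N)
      (Rabs (real (Lim_seq (U x)) - U x N)) (L - A N));
      [exists N; intros M HM; now apply Mtest_tail| |apply is_lim_seq_const].
    apply (is_lim_seq_abs _ (Finite _)).
    apply is_lim_seq_minus'; [apply Hcv|apply is_lim_seq_const]. }
  exact Hb.
Qed.

End Mtest.

(** * Integrals of a bounded derivative against a monotone function *)

Section Monotone.

Variables (Phi phi g : R -> R) (a b K B : R).
Hypothesis Phi_deriv : forall x, is_derive Phi x (phi x).
Hypothesis phi_cont : forall x, continuous phi x.
Hypothesis g_cont : forall x, continuous g x.
Hypothesis phi_le : forall x, Rabs (phi x) <= B.
Hypothesis Phi_le : forall x, Rabs (Phi x) <= K.

(** The defect in integration by parts: it stands for the Stieltjes integral [- int Phi dg] without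
    assuming [g] differentiable, and is additive over adjacent intervals. *)
Let E (g : R -> R) (c d : R) : R :=
  RInt (fun x => phi x * g x) c d - (Phi d * g d - Phi c * g c).

Lemma ex_RInt_phi_mult (h : R -> R) (c d : R) :
  (forall x, continuous h x) -> ex_RInt (fun x => phi x * h x) c d.
Proof.
  intros Hh. apply (ex_RInt_continuous (V := R_CompleteNormedModule)).
  intros x _. apply (continuous_mult phi h); [apply phi_cont|apply Hh].
Qed.

(* Bisecting [j] times scales the [B]-term of the trivial bound by [2^-j]. *)
Lemma RInt_mult_nondecreasing_le (j : nat) (c d : R) :
  (forall x y, a <= x -> x <= y -> y <= b -> g x <= g y) ->
  a <= c -> c <= d -> d <= b ->
  Rabs (E g c d) <= (B * (d - c) / 2 ^ j + K) * (g d - g c).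
Proof.
  intros g_incr. revert c d.
  induction j as [|j IH]; intros c d Hac Hcd Hdb.
  (* [E] is linear in [g] and vanishes on constants, so [g] may be replaced by [g - g c], which
     kills the boundary term at [c]. *)
  - assert (HE : E g c d = RInt (fun x => phi x * (g x - g c)) c d
                           - Phi d * (g d - g c)).
    { unfold E.
      assert (HI : is_RInt phi c d (Phi d - Phi c)).
      { apply (is_RInt_derive (V := R_CompleteNormedModule) Phi phi);
          intros; [apply Phi_deriv|apply phi_cont]. }
      assert (H1 : is_RInt (fun x => phi x * g x) c d
        (RInt (fun x => phi x * (g x - g c)) c d + g c * (Phi d - Phi c))).
      { apply (is_RInt_ext (V := R_NormedModule)
          (fun x => plus (phi x * (g x - g c)) (scal (g c) (phi x)))).
        - intros x _. unfold plus, scal; simpl. unfold mult; simpl; ring.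
        - apply (is_RInt_plus (V := R_NormedModule)).
          + apply (RInt_correct (V := R_CompleteNormedModule)).
            apply (ex_RInt_phi_mult (fun x => g x - g c)). intros x.
            apply (continuous_minus g (fun _ => g c));
              [apply g_cont|apply continuous_const].
          + apply (is_RInt_scal (V := R_NormedModule)), HI. }
      rewrite (is_RInt_unique _ _ _ _ H1). ring. }
    rewrite HE.
    assert (Rabs (RInt (fun x => phi x * (g x - g c)) c d)
            <= (d - c) * (B * (g d - g c))).
    { apply abs_RInt_le_const; [exact Hcd| |].
      - apply (ex_RInt_phi_mult (fun x => g x - g c)). intros x.
        apply (continuous_minus g (fun _ => g c));
          [apply g_cont|apply continuous_const].
      - intros t Ht. rewrite Rabs_mult.
        apply Rmult_le_compat; try apply Rabs_pos; [apply phi_le|].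
        assert (g c <= g t) by (apply g_incr; lra).
        assert (g t <= g d) by (apply g_incr; lra).
        rewrite Rabs_pos_eq; lra. }
    assert (Rabs (Phi d * (g d - g c)) <= K * (g d - g c)).
    { assert (g c <= g d) by (apply g_incr; lra).
      rewrite Rabs_mult, (Rabs_pos_eq (g d - g c)) by lra.
      apply Rmult_le_compat_r; [lra|apply Phi_le]. }
    unfold Rminus at 1. eapply Rle_trans; [apply Rabs_triang|].
    rewrite Rabs_Ropp. simpl; unfold Rdiv; rewrite Rinv_1, Rmult_1_r. lra.
  (* Each half has half the length, which supplies the extra factor 1/2, while the increments of [g]
     over the halves add up to [g d - g c]. *)
  - set (e := (c + d) / 2).
    assert (HE : E g c d = E g c e + E g e d).
    { unfold E.
      rewrite <- (RInt_Chasles (V := R_CompleteNormedModule) _ c e d)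
        by (apply ex_RInt_phi_mult, g_cont).
      unfold plus; simpl; ring. }
    rewrite HE. eapply Rle_trans; [apply Rabs_triang|].
    eapply Rle_trans; [apply Rplus_le_compat; apply IH; unfold e; lra|].
    apply Req_le. unfold e; simpl. field. apply pow_nonzero; lra.
Qed.

(** As [j] tends to infinity the term with [B] disappears and only the bound [K] on [Phi]
    remains. *)
Lemma RInt_mult_nondecreasing_lim :
  (forall x y, a <= x -> x <= y -> y <= b -> g x <= g y) -> a <= b ->
  Rabs (E g a b) <= K * (g b - g a).
Proof.
  intros g_incr Hab.
  apply (is_lim_seq_le (fun _ => Rabs (E g a b))
    (fun j => (B * (b - a) * (/ 2) ^ j + K) * (g b - g a))
    (Rabs (E g a b)) (K * (g b - g a))); [|apply is_lim_seq_const|].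
  - intros j. rewrite pow_inv.
    apply RInt_mult_nondecreasing_le; [exact g_incr|lra..].
  - apply (is_lim_seq_scal_r _ _ (Finite K)).
    replace (Finite K) with (Finite (B * (b - a) * 0 + K)) by (f_equal; ring).
    apply is_lim_seq_plus'; [|apply is_lim_seq_const].
    apply (is_lim_seq_scal_l _ _ (Finite 0)).
    apply is_lim_seq_geom. rewrite Rabs_pos_eq; lra.
Qed.

End Monotone.

(** The boundary terms of [E] vanish with [Phi a] and [Phi b]; a nonincreasing [g] is handled
    through [- g]. *)
Lemma RInt_mult_monotone_le (Phi phi g : R -> R) (a b K B : R) :
  (forall x, is_derive Phi x (phi x)) ->
  (forall x, continuous phi x) ->
  (forall x, continuous g x) ->
  (forall x, Rabs (phi x) <= B) ->
  (forall x, Rabs (Phi x) <= K) ->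
  Phi a = 0 -> Phi b = 0 -> a <= b -> monotone_on a b g ->
  Rabs (RInt (fun x => phi x * g x) a b) <= K * Rabs (g a - g b).
Proof.
  intros HPhi Hphi Hg HB HK Ha Hb Hab [Hincr|Hdecr].
  - generalize (RInt_mult_nondecreasing_lim Phi phi g a b K B
                  HPhi Hphi Hg HB HK Hincr Hab).
    rewrite Ha, Hb, (Rabs_minus_sym (g a)).
    assert (g a <= g b) by (apply Hincr; lra).
    rewrite (Rabs_pos_eq (g b - g a)) by lra.
    rewrite !Rmult_0_l, !Rminus_0_r; easy.
  - assert (Hopp : forall x, continuous (fun x => - g x) x)
      by (intros x; apply (continuous_opp g), Hg).
    assert (Hincr : forall x y, a <= x -> x <= y -> y <= b -> - g x <= - g y)
      by (intros x y H1 H2 H3; apply Ropp_le_contravar; auto).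
    generalize (RInt_mult_nondecreasing_lim Phi phi (fun x => - g x) a b K B
                  HPhi Hphi Hopp HB HK Hincr Hab).
    rewrite Ha, Hb.
    assert (g b <= g a) by (apply Hdecr; lra).
    rewrite (Rabs_pos_eq (g a - g b)) by lra.
    rewrite !Rmult_0_l, !Rminus_0_r.
    replace (RInt (fun x => phi x * - g x) a b)
      with (- RInt (fun x => phi x * g x) a b).
    + rewrite Rabs_Ropp. replace (- g b - - g a) with (g a - g b) by ring. easy.
    + rewrite <- (RInt_opp (V := R_CompleteNormedModule)).
      * apply RInt_ext; intros x _. unfold opp; simpl; ring.
      * now apply ex_RInt_phi_mult.
Qed.

(* Outside [a, b] the function [g] is arbitrary; precomposing with [clamp] makes it
   globally continuous without changing integrals over [a, b]. *)
Definition clamp (a b x : R) : R := Rmax a (Rmin b x).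

Lemma clamp_in (a b x : R) : a <= b -> Icc a b (clamp a b x).
Proof.
  intros Hab; unfold Icc, clamp, Rmax, Rmin; repeat destruct Rle_dec; lra.
Qed.

Lemma clamp_id (a b x : R) : Icc a b x -> clamp a b x = x.
Proof.
  unfold Icc, clamp, Rmax, Rmin; intros Hx; repeat destruct Rle_dec; lra.
Qed.

Lemma continuous_clamp (a b : R) (g : R -> R) :
  a <= b -> continuous_on (Icc a b) g ->
  forall x, continuous (fun y => g (clamp a b y)) x.
Proof.
  intros Hab Hg x P HP.
  destruct (Hg (clamp a b x) (clamp_in a b x Hab) P HP) as [eps Heps].
  exists eps; intros y Hy. apply Heps; [|now apply clamp_in].
  revert Hy; unfold ball; simpl; unfold AbsRing_ball, abs, minus, plus, opp; simpl.
  intros Hy; eapply Rle_lt_trans; [|exact Hy].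
  (* [clamp] is 1-Lipschitz, so the same radius [eps] serves. *)
  unfold clamp, Rmax, Rmin, Rabs; repeat destruct Rle_dec; repeat destruct Rcase_abs; lra.
Qed.

(** * Termwise calculus and transfer from real to complex values *)

Lemma is_derive_sum_n_m (u : nat -> R -> R) (d : nat -> R) (m N : nat) (x : R) :
  (forall k, (m <= k)%nat -> is_derive (u k) x (d k)) ->
  is_derive (fun y => sum_n_m (fun k => u k y) m N) x (sum_n_m d m N).
Proof.
  intros Hu.
  assert (Hz : forall M, (M < m)%nat ->
    is_derive (fun y => sum_n_m (fun k => u k y) m M) x (sum_n_m d m M)).
  { intros M HM. rewrite sum_n_m_zero by exact HM.
    apply (is_derive_ext (fun _ => zero)).
    - intros t; now rewrite sum_n_m_zero.
    - apply (is_derive_const (V := R_NormedModule)). }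
  induction N as [|N IH].
  - destruct m as [|m]; [|apply Hz; lia].
    rewrite sum_n_n. apply (is_derive_ext (u 0%nat)).
    + intros t; now rewrite sum_n_n.
    + apply Hu; lia.
  - destruct (Nat.le_gt_cases m (S N)) as [Hm|Hm]; [|apply Hz; lia].
    rewrite sum_n_Sm by exact Hm.
    apply (is_derive_ext
      (fun y => plus (sum_n_m (fun k => u k y) m N) (u (S N) y))).
    + intros t; now rewrite sum_n_Sm.
    + apply (is_derive_plus (V := R_NormedModule)); [exact IH|now apply Hu].
Qed.

Lemma continuous_sum_n_m (u : nat -> R -> R) (m N : nat) (x : R) :
  (forall k, continuous (u k) x) ->
  continuous (fun y => sum_n_m (fun k => u k y) m N) x.
Proof.
  intros Hu.
  assert (Hz : forall M, (M < m)%nat ->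
    continuous (fun y => sum_n_m (fun k => u k y) m M) x).
  { intros M HM. apply (continuous_ext (fun _ => 0)).
    - intros t; now rewrite sum_n_m_zero.
    - apply continuous_const. }
  induction N as [|N IH].
  - destruct m as [|m]; [|apply Hz; lia].
    apply (continuous_ext (u 0%nat)); [|apply Hu].
    intros t; now rewrite sum_n_n.
  - destruct (Nat.le_gt_cases m (S N)) as [Hm|Hm]; [|apply Hz; lia].
    apply (continuous_ext
      (fun y => plus (sum_n_m (fun k => u k y) m N) (u (S N) y))).
    + intros t; now rewrite sum_n_Sm.
    + apply (continuous_plus (V := R_NormedModule)); [exact IH|apply Hu].
Qed.

(** With its analogue for sequences below, this confines the complex numbers to one constant factor
    [w], so that all estimates are real. *)
Lemma is_RInt_Cmult_RtoC (w : C) (h : R -> R) (a b I : R) :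
  is_RInt h a b I ->
  is_RInt (V := C_R_NormedModule) (fun x => (w * RtoC (h x))%C) a b
    (w * RtoC I)%C.
Proof.
  intros HI. destruct w as [w1 w2].
  apply (is_RInt_fct_extend_pair (U := R_NormedModule) (V := R_NormedModule));
    simpl.
  - apply (is_RInt_ext (V := R_NormedModule) (fun x => scal w1 (h x))).
    + intros x _; unfold scal; simpl; unfold mult; simpl; ring.
    + replace (w1 * I - w2 * 0) with (scal w1 I)
        by (unfold scal; simpl; unfold mult; simpl; ring).
      now apply (is_RInt_scal (V := R_NormedModule)).
  - apply (is_RInt_ext (V := R_NormedModule) (fun x => scal w2 (h x))).
    + intros x _; unfold scal; simpl; unfold mult; simpl; ring.
    + replace (w1 * 0 + w2 * I) with (scal w2 I)
        by (unfold scal; simpl; unfold mult; simpl; ring).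
      now apply (is_RInt_scal (V := R_NormedModule)).
Qed.

Lemma filterlim_Cmult_RtoC (w : C) (u : nat -> R) (l : R) :
  is_lim_seq u l ->
  filterlim (fun N => (w * RtoC (u N))%C) eventually
    (locally (T := C_R_CompleteNormedModule) (w * RtoC l)%C).
Proof.
  intros Hu. destruct w as [w1 w2].
  assert (H1 : is_lim_seq (fun N => w1 * u N - w2 * 0) (w1 * l - w2 * 0)).
  { apply is_lim_seq_minus'; [|apply is_lim_seq_const].
    now apply (is_lim_seq_scal_l _ _ (Finite l)). }
  assert (H2 : is_lim_seq (fun N => w1 * 0 + w2 * u N) (w1 * 0 + w2 * l)).
  { apply is_lim_seq_plus'; [apply is_lim_seq_const|].
    now apply (is_lim_seq_scal_l _ _ (Finite l)). }
  apply (filterlim_locally (U := C_R_CompleteNormedModule)). intros eps.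
  generalize (proj1 (filterlim_locally _ _) H1 eps)
    (proj1 (filterlim_locally _ _) H2 eps).
  intros E1 E2. generalize (filter_and _ _ E1 E2).
  apply filter_imp. intros N [B1 B2]; split; assumption.
Qed.

(** * The terms [k] and [-k] of the kernel taken together *)

(** Convertible with the summand inside [remainder], so that [change] can introduce it there. *)
Definition Zterm (n : nat) (x : R) (k : Z) : C :=
  (Cexp (two_pi_i_k k * RtoC x) / two_pi_i_k k ^ n)%C.

Lemma Cexp_two_pi_i_k (k : Z) (x : R) :
  Cexp (two_pi_i_k k * RtoC x)%C
  = (cos (2 * PI * IZR k * x), sin (2 * PI * IZR k * x)).
Proof.
  unfold Cexp, two_pi_i_k, Re, Im; simpl.
  replace (_ * x - _ * 0) with 0 by ring.
  replace (_ * 0 + _ * x) with (2 * PI * IZR k * x) by ring.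
  rewrite exp_0, !Rmult_1_l; reflexivity.
Qed.

Lemma two_pi_i_k_nat (k : nat) :
  two_pi_i_k (Z.of_nat k) = (Ci * RtoC (2 * PI * INR k))%C.
Proof. unfold two_pi_i_k. rewrite <- INR_IZR_INZ, (RtoC_mult (2 * PI)). ring. Qed.

Lemma two_pi_i_k_opp (k : Z) : two_pi_i_k (- k) = (RtoC (-1) * two_pi_i_k k)%C.
Proof.
  unfold two_pi_i_k. replace (IZR (- k)) with (-1 * IZR k).
  - rewrite (RtoC_mult (-1)). ring.
  - rewrite opp_IZR; ring.
Qed.

(** The exponentials at [k] and [-k] are conjugate and their denominators differ by the factor
    [(-1) ^ n]. The division by 2 compensates the 2 inside [coef]. *)
Lemma Zterm_pair (n k : nat) (x : R) :
  (0 < k)%nat ->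
  (Zterm n x (Z.of_nat k) + Zterm n x (- Z.of_nat k))%C
  = (/ Ci ^ n * RtoC (coef n k)
     * ((cos (2 * PI * INR k * x), sin (2 * PI * INR k * x))
        + RtoC ((-1) ^ n) *
          (cos (2 * PI * INR k * x), (- sin (2 * PI * INR k * x))%R))
     / RtoC 2)%C.
Proof.
  intros Hk. unfold Zterm.
  rewrite !Cexp_two_pi_i_k, two_pi_i_k_opp, opp_IZR, two_pi_i_k_nat.
  rewrite <- INR_IZR_INZ.
  replace (2 * PI * - INR k * x) with (- (2 * PI * INR k * x)) by ring.
  rewrite cos_neg, sin_neg.
  set (e1 := (cos _, sin _)). set (e2 := (cos _, _)).
  assert (Hc : 2 * PI * INR k <> 0).
  { assert (0 < INR k) by (now apply lt_0_INR). generalize PI_RGT_0.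
    intros; apply Rgt_not_eq, Rmult_lt_0_compat; lra. }
  unfold coef. rewrite RtoC_div by (now apply pow_nonzero).
  rewrite !Cpow_mult_l, <- !RtoC_pow.
  (* [(-1) ^ n] is its own inverse, hence may move from the denominator to the numerator. *)
  assert (Hm : (RtoC ((-1) ^ n) * RtoC ((-1) ^ n) = 1)%C).
  { rewrite <- RtoC_mult, <- Rpow_mult_distr.
    replace (-1 * -1) with 1 by ring. now rewrite pow1. }
  assert (Hi : (Ci ^ n)%C <> 0) by (apply Cpow_nz; intros H; injection H; lra).
  assert (HC : RtoC ((2 * PI * INR k) ^ n) <> 0)
    by (intros H; apply RtoC_inj in H; revert H; now apply pow_nonzero).
  assert (Hm0 : RtoC ((-1) ^ n) <> 0)
    by (intros H; apply RtoC_inj in H; revert H; apply pow_nonzero; lra).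
  assert (H2 : RtoC 2 <> 0) by (intros H; apply RtoC_inj in H; lra).
  assert (Hinv : (/ RtoC ((-1) ^ n) = RtoC ((-1) ^ n))%C).
  { rewrite <- (Cmult_1_l (/ _)), <- Hm. field. exact Hm0. }
  unfold Cdiv.
  replace (/ (RtoC ((-1) ^ n) * (Ci ^ n * RtoC ((2 * PI * INR k) ^ n))))%C
    with (RtoC ((-1) ^ n) * / (Ci ^ n * RtoC ((2 * PI * INR k) ^ n)))%C.
  - field. auto.
  - rewrite <- Hinv at 1. field. auto.
Qed.

(** With sign [+1] the sines cancel and [2 cos] is left. *)
Lemma Zterm_pair_even (n k : nat) (x : R) :
  Nat.Even n -> (0 < k)%nat ->
  (Zterm n x (Z.of_nat k) + Zterm n x (- Z.of_nat k))%C
  = (/ Ci ^ n * RtoC (coef n k * cos (2 * PI * INR k * x)))%C.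
Proof.
  intros [m Hm] Hk. rewrite Zterm_pair by exact Hk.
  replace ((-1) ^ n) with 1.
  - set (t := 2 * PI * INR k * x).
    replace ((cos t, sin t) + RtoC 1 * (cos t, (- sin t)%R))%C
      with (RtoC 2 * RtoC (cos t))%C.
    + rewrite RtoC_mult.
      assert (Ci ^ n <> 0)%C by (apply Cpow_nz; intros H; injection H; lra).
      field; assumption.
    + apply injective_projections; simpl; ring.
  - rewrite Hm, pow_mult. replace ((-1) ^ 2) with 1 by ring. now rewrite pow1.
Qed.

(** With sign [-1] the cosines cancel and [2 i sin] is left, whence the extra [Ci] in the
    constant. *)
Lemma Zterm_pair_odd (n k : nat) (x : R) :
  Nat.Odd n -> (0 < k)%nat ->
  (Zterm n x (Z.of_nat k) + Zterm n x (- Z.of_nat k))%C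
  = (Ci / Ci ^ n * RtoC (coef n k * sin (2 * PI * INR k * x)))%C.
Proof.
  intros [m Hm] Hk. rewrite Zterm_pair by exact Hk.
  replace ((-1) ^ n) with (-1).
  - set (t := 2 * PI * INR k * x).
    replace ((cos t, sin t) + RtoC (-1) * (cos t, (- sin t)%R))%C
      with (RtoC 2 * Ci * RtoC (sin t))%C.
    + assert (Ci ^ n <> 0)%C by (apply Cpow_nz; intros H; injection H; lra).
      rewrite RtoC_mult. field; assumption.
    + apply injective_projections; simpl; ring.
  - rewrite Hm, pow_add, pow_mult. replace ((-1) ^ 2) with 1 by ring.
    rewrite pow1; simpl; ring.
Qed.

Lemma Cmod_Ci : Cmod Ci = 1.
Proof.
  unfold Cmod, Ci; simpl. transitivity (sqrt 1); [f_equal; ring|apply sqrt_1].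
Qed.

Lemma Cmod_inv_Ci_pow (n : nat) : Cmod (/ Ci ^ n) = 1.
Proof.
  rewrite Cmod_inv by (apply Cpow_nz; intros H; injection H; lra).
  rewrite Cmod_pow, Cmod_Ci, pow1. field.
Qed.

Lemma continuous_on_subset_Icc (a b c d : R) (g : R -> R) :
  a <= c -> d <= b -> continuous_on (Icc a b) g -> continuous_on (Icc c d) g.
Proof.
  intros Hac Hdb Hg x Hx P HP.
  assert (Hx' : Icc a b x) by (unfold Icc in *; lra).
  destruct (Hg x Hx' P HP) as [eps Heps]; exists eps.
  intros y Hy Hy'; apply Heps; [exact Hy|unfold Icc in *; lra].
Qed.

(** Uniqueness of limits makes [iota] return the limit of the paired sums. These start at [S p], so
    the pairing formula is applied to positive [k] only. *)
Lemma sum_Z_gt_Zterm (n p : nat) (w : C) (u : nat -> R) (x l : R) :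
  (forall k, (0 < k)%nat ->
     (Zterm n x (Z.of_nat k) + Zterm n x (- Z.of_nat k))%C
     = (w * RtoC (u k))%C) ->
  is_lim_seq (fun N => sum_n_m u (S p) N) l ->
  sum_Z_gt p (Zterm n x) = (w * RtoC l)%C.
Proof.
  intros Hu Hl.
  apply (iota_filterlim_locally (V := C_R_CompleteNormedModule)).
  apply filterlim_ext with (2 := filterlim_Cmult_RtoC w _ l Hl).
  intros N. symmetry.
  induction N as [|N IH].
  - rewrite !sum_n_m_zero by lia.
    apply injective_projections; unfold zero; simpl; ring.
  - destruct (Nat.le_gt_cases p N) as [Hp|Hp].
    + rewrite !sum_n_Sm by lia. rewrite IH, (Hu (S N)) by lia.
      unfold plus; simpl plus.
      apply injective_projections; simpl; ring.
    + rewrite !sum_n_m_zero by lia.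
      apply injective_projections; unfold zero; simpl; ring.
Qed.

(** * Both bounds on the remainder, for the two parities at once *)

Section Remainder.

(** The triple [(h, H, D)] will be [(cos, sin, 1)] for even [n] and [(sin, 1 - cos, 2)] for odd [n],
    with [w] equal to [/ Ci ^ n] and [Ci / Ci ^ n] respectively. *)
Variables (h H : R -> R) (D : R) (w : C) (n p : nat).
Hypothesis n_ge_2 : (2 <= n)%nat.
Hypothesis Cmod_w : Cmod w = 1.
Hypothesis Zterm_h : forall k x, (0 < k)%nat ->
  (Zterm n x (Z.of_nat k) + Zterm n x (- Z.of_nat k))%C
  = (w * RtoC (coef n k * h (2 * PI * INR k * x)))%C.
Hypothesis H_deriv : forall x, is_derive H x (h x).
Hypothesis h_cont : forall x, continuous h x.
Hypothesis h_le : forall x, Rabs (h x) <= 1.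
Hypothesis H_le : forall x, Rabs (H x) <= D.
Hypothesis H_zero : forall k : Z, H (2 * PI * IZR k) = 0.

Let u (k : nat) (x : R) : R := coef n k * h (2 * PI * INR k * x).
Let U (k : nat) (x : R) : R := coef (n + 1) k * H (2 * PI * INR k * x).
Let phi (N : nat) (x : R) : R := sum_n_m (fun k => u k x) (S p) N.
Let Phi (N : nat) (x : R) : R := sum_n_m (fun k => U k x) (S p) N.

Lemma u_le_coef (k : nat) (x : R) : (p < k)%nat -> Rabs (u k x) <= coef n k.
Proof.
  intros Hk. unfold u. assert (Hc := coef_nonneg n k ltac:(lia)).
  rewrite Rabs_mult, (Rabs_pos_eq (coef n k)) by exact Hc.
  rewrite <- (Rmult_1_r (coef n k)) at 2.
  now apply Rmult_le_compat_l.
Qed.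

Lemma U_le_coef (k : nat) (x : R) :
  (p < k)%nat -> Rabs (U k x) <= D * coef (n + 1) k.
Proof.
  intros Hk. unfold U. assert (Hc := coef_nonneg (n + 1) k ltac:(lia)).
  rewrite Rabs_mult, (Rabs_pos_eq (coef (n + 1) k)), Rmult_comm by exact Hc.
  now apply Rmult_le_compat_r.
Qed.

Lemma phi_le_T (N : nat) (x : R) : Rabs (phi N x) <= T n p.
Proof.
  exact (Mtest_bound u (coef n) p (T n p) u_le_coef (is_lim_seq_T n p n_ge_2)
           x N).
Qed.

Lemma Phi_le_T (N : nat) (x : R) : Rabs (Phi N x) <= D * T (n + 1) p.
Proof.
  apply (Mtest_bound U (fun k => D * coef (n + 1) k) p _ U_le_coef).
  apply is_lim_seq_ext
    with (fun N => D * sum_n_m (coef (n + 1)) (S p) N).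
  - intros M. symmetry. apply (sum_n_m_mult_l (K := R_Ring)).
  - apply (is_lim_seq_scal_l _ _ (Finite _)), is_lim_seq_T. lia.
Qed.

Lemma is_derive_Phi (N : nat) (x : R) : is_derive (Phi N) x (phi N x).
Proof.
  apply (is_derive_sum_n_m U (fun k => u k x)). intros k Hk.
  unfold U, u.
  assert (Hd : is_derive (fun y => H (2 * PI * INR k * y)) x
                 (2 * PI * INR k * h (2 * PI * INR k * x))).
  { apply (is_derive_comp H (fun y => 2 * PI * INR k * y)).
    - apply H_deriv.
    - auto_derive; [exact I|ring]. }
  (* The chain rule factor [2 * PI * INR k] lowers the exponent in [coef] from [n + 1] to [n]; it is
     nonzero since [k > p]. *)
  replace (coef n k * h (2 * PI * INR k * x))
    with (coef (n + 1) k * (2 * PI * INR k * h (2 * PI * INR k * x))).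
  - now apply (is_derive_scal (fun y => H (2 * PI * INR k * y))).
  - unfold coef.
    assert (0 < 2 * PI * INR k).
    { apply Rmult_lt_0_compat; [generalize PI_RGT_0; lra|].
      apply lt_0_INR; lia. }
    set (c := 2 * PI * INR k) in *.
    rewrite pow_add, pow_1. field. split; [apply pow_nonzero|]; lra.
Qed.

Lemma continuous_phi (N : nat) (x : R) : continuous (phi N) x.
Proof.
  apply continuous_sum_n_m. intros k. unfold u.
  apply (continuous_mult (fun _ => coef n k)); [apply continuous_const|].
  apply (continuous_comp (fun y => 2 * PI * INR k * y) h); [|apply h_cont].
  apply (continuous_mult (fun _ => 2 * PI * INR k));
    [apply continuous_const|apply continuous_id].
Qed.

(** At an integer every argument of [H] is a multiple of [2 * PI]. This is where integrality of the
    end points enters. *)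
Lemma Phi_IZR (N : nat) (j : Z) : Phi N (IZR j) = 0.
Proof.
  unfold Phi. rewrite (sum_n_m_ext _ (fun _ => zero)).
  - apply (sum_n_m_const_zero (G := R_AbelianMonoid)).
  - intros k. unfold U.
    replace (2 * PI * INR k * IZR j) with (2 * PI * IZR (Z.of_nat k * j))
      by (rewrite mult_IZR, <- INR_IZR_INZ; ring).
    rewrite H_zero. apply Rmult_0_r.
Qed.

(** Uniform convergence of [phi N] and boundedness of the clamped [g] let the integral pass to the
    limit; the complex factors left over have modulus 1. *)
Lemma remainder_eq (a b : R) (g : R -> R) :
  a <= b -> continuous_on (Icc a b) g ->
  exists I : R,
    is_lim_seq (fun N => RInt (fun x => phi N x * g (clamp a b x)) a b) I /\
    Cmod (remainder a b n p g) = Rabs I.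
Proof.
  intros Hab Hg.
  destruct (Mtest u (coef n) p (T n p) u_le_coef (is_lim_seq_T n p n_ge_2))
    as (v & Hv & Htail).
  assert (Hgc := continuous_clamp a b g Hab Hg).
  destruct (continuity_ab_maj (fun x => Rabs (g (clamp a b x))) a b Hab)
    as (x0 & Hx0 & _).
  { intros x _. apply continuity_pt_filterlim.
    apply (continuous_comp (fun x => g (clamp a b x)) Rabs);
      [apply Hgc|apply continuous_Rabs]. }
  set (G := Rabs (g (clamp a b x0))) in Hx0.
  (* Uniform convergence is required on all of [R]; clamping turns the maximum over [[a, b]] into a
     global bound. *)
  assert (HG : forall x, Rabs (g (clamp a b x)) <= G).
  { intros x. specialize (Hx0 (clamp a b x) (clamp_in a b x Hab)).
    rewrite (clamp_id a b (clamp a b x)) in Hx0 by now apply clamp_in.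
    exact Hx0. }
  destruct (filterlim_RInt (V := R_CompleteNormedModule)
    (fun N x => phi N x * g (clamp a b x)) a b eventually _
    (fun x => v x * g (clamp a b x))
    (fun N => RInt (fun x => phi N x * g (clamp a b x)) a b))
    as (I & HI & HRI).
  - intros N. apply (RInt_correct (V := R_CompleteNormedModule)).
    apply (ex_RInt_continuous (V := R_CompleteNormedModule)). intros x _.
    apply (continuous_mult (phi N)); [apply continuous_phi|apply Hgc].
  - apply (filterlim_locally (U := fct_UniformSpace R R_UniformSpace)).
    intros eps.
    assert (HG0 : 0 <= G) by apply Rabs_pos.
    (* [G + 1] replaces [G] to keep the divisor positive when [g] vanishes on [[a, b]]. *)
    assert (Heps : 0 < eps / (G + 1))
      by (apply Rdiv_lt_0_compat; [apply cond_pos|lra]).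
    generalize (proj2 (is_lim_seq_spec _ (Finite _)) (is_lim_seq_T n p n_ge_2)
                  (mkposreal _ Heps)).
    apply filter_imp. intros N HN x. simpl in HN.
    unfold ball; simpl; unfold AbsRing_ball, abs, minus, plus, opp; simpl.
    specialize (Htail x N).
    change (Rabs (phi N x * g (clamp a b x) + - (v x * g (clamp a b x))) < eps).
    replace (_ + _) with (- ((v x - phi N x) * g (clamp a b x))) by ring.
    rewrite Rabs_Ropp, Rabs_mult.
    apply Rle_lt_trans with (Rabs (v x - phi N x) * (G + 1)).
    + apply Rmult_le_compat_l; [apply Rabs_pos|]. specialize (HG x); lra.
    + replace (pos eps) with (eps / (G + 1) * (G + 1)) by (field; lra).
      apply Rmult_lt_compat_r; [lra|].
      apply Rle_lt_trans with (1 := Htail).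
      apply Rabs_def2 in HN.
      change (sum_n_m (coef n) (S p) N - T n p < eps / (G + 1)
              /\ - (eps / (G + 1)) < sum_n_m (coef n) (S p) N - T n p) in HN.
      lra.
  - exists I. split; [exact HI|].
    assert (HR : RInt (V := C_R_CompleteNormedModule)
      (fun x => (sum_Z_gt p (Zterm n x) * RtoC (g x))%C) a b = (w * RtoC I)%C).
    { apply (is_RInt_unique (V := C_R_CompleteNormedModule)).
      apply (is_RInt_ext (V := C_R_NormedModule)
               (fun x => (w * RtoC (v x * g (clamp a b x)))%C)).
      (* The integrands need only agree inside the interval, where [clamp] is the identity. *)
      - intros x Hx. rewrite Rmin_left, Rmax_right in Hx by exact Hab.
        rewrite clamp_id by (unfold Icc; lra).
        rewrite (sum_Z_gt_Zterm n p w (fun k => u k x) x (v x)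
                   (fun k Hk => Zterm_h k x Hk) (Hv x)).
        apply injective_projections; simpl; ring.
      - now apply is_RInt_Cmult_RtoC. }
    unfold remainder.
    change (Cmod (RtoC ((-1) ^ n) * RInt (V := C_R_CompleteNormedModule)
      (fun x => (sum_Z_gt p (Zterm n x) * RtoC (g x))%C) a b) = Rabs I).
    rewrite HR, !Cmod_mult, Cmod_w, !Cmod_R, <- RPow_abs.
    rewrite Rabs_m1, pow1. ring.
Qed.

(** Each partial sum satisfies the bound because [phi N] is at most [T n p] in absolute value; the
    inequality survives the limit. *)
Lemma Cmod_remainder_le (a b : R) (g : R -> R) :
  a <= b -> continuous_on (Icc a b) g ->
  Cmod (remainder a b n p g) <= T n p * RInt (fun x => Rabs (g x)) a b.
Proof.
  intros Hab Hg.
  destruct (remainder_eq a b g Hab Hg) as (I & HI & ->).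
  assert (Hgc := continuous_clamp a b g Hab Hg).
  assert (Hga : forall x, continuous (fun x => Rabs (g (clamp a b x))) x).
  { intros x. apply (continuous_comp (fun x => g (clamp a b x)) Rabs);
      [apply Hgc|apply continuous_Rabs]. }
  rewrite (RInt_ext (fun x => Rabs (g x)) (fun x => Rabs (g (clamp a b x)))).
  2:{ intros x Hx. rewrite Rmin_left, Rmax_right in Hx by exact Hab.
      rewrite clamp_id by (unfold Icc; lra). reflexivity. }
  apply (is_lim_seq_le
    (fun N => Rabs (RInt (fun x => phi N x * g (clamp a b x)) a b))
    (fun _ => T n p * RInt (fun x => Rabs (g (clamp a b x))) a b)
    (Rabs I) (Finite _)); [|now apply (is_lim_seq_abs _ (Finite I))
                            |apply is_lim_seq_const].
  intros N.
  assert (Hc : forall x, continuous (fun x => phi N x * g (clamp a b x)) x)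
    by (intros x; apply (continuous_mult (phi N));
        [apply continuous_phi|apply Hgc]).
  eapply Rle_trans; [apply abs_RInt_le; [exact Hab|]|].
  - apply (ex_RInt_continuous (V := R_CompleteNormedModule)); intros; apply Hc.
  - assert (Hscal := RInt_scal (V := R_CompleteNormedModule)
      (fun x => Rabs (g (clamp a b x))) a b (T n p)
      (ex_RInt_continuous (V := R_CompleteNormedModule) _ a b
         (fun x _ => Hga x))).
    change (RInt (fun x => T n p * Rabs (g (clamp a b x))) a b
            = T n p * RInt (fun x => Rabs (g (clamp a b x))) a b) in Hscal.
    rewrite <- Hscal.
    apply RInt_le; [exact Hab| | |].
    + apply (ex_RInt_continuous (V := R_CompleteNormedModule)); intros x _.
      apply (continuous_comp (fun x => phi N x * g (clamp a b x)) Rabs);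
        [apply Hc|apply continuous_Rabs].
    + apply (ex_RInt_continuous (V := R_CompleteNormedModule)); intros x _.
      apply (continuous_scal_r (V := R_NormedModule)), Hga.
    + intros x _. rewrite Rabs_mult.
      apply Rmult_le_compat_r; [apply Rabs_pos|apply phi_le_T].
Qed.

(** The monotone estimate applies to each [Phi N], which vanishes at both integer end points; its
    bound does not depend on [N]. *)
Lemma Cmod_remainder_monotone_le (a b : Z) (g : R -> R) :
  IZR a <= IZR b -> continuous_on (Icc (IZR a) (IZR b)) g ->
  monotone_on (IZR a) (IZR b) g ->
  Cmod (remainder (IZR a) (IZR b) n p g)
  <= D * T (n + 1) p * Rabs (g (IZR a) - g (IZR b)).
Proof.
  intros Hab Hg Hm.
  destruct (remainder_eq (IZR a) (IZR b) g Hab Hg) as (I & HI & ->).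
  assert (Hgc := continuous_clamp (IZR a) (IZR b) g Hab Hg).
  set (gc := fun x => g (clamp (IZR a) (IZR b) x)) in *.
  assert (Hid : forall x, IZR a <= x <= IZR b -> gc x = g x)
    by (intros x Hx; unfold gc; now rewrite clamp_id).
  apply (is_lim_seq_le (fun N => Rabs (RInt (fun x => phi N x * gc x)
                                         (IZR a) (IZR b)))
    (fun _ => D * T (n + 1) p * Rabs (g (IZR a) - g (IZR b)))
    (Rabs I) (Finite _)); [|now apply (is_lim_seq_abs _ (Finite I))
                            |apply is_lim_seq_const].
  intros N.
  rewrite <- (Hid (IZR a)), <- (Hid (IZR b)) by lra.
  apply (RInt_mult_monotone_le (Phi N) (phi N) gc _ _ _ (T n p)).
  - apply is_derive_Phi.
  - apply continuous_phi.
  - exact Hgc.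
  - apply phi_le_T.
  - apply Phi_le_T.
  - apply Phi_IZR.
  - apply Phi_IZR.
  - exact Hab.
  - destruct Hm as [Hm|Hm]; [left|right]; intros x y H1 H2 H3;
      rewrite !Hid by lra; apply Hm; lra.
Qed.

End Remainder.

(** * Specialisation to cosine and sine *)

Lemma sin_2PI_IZR (k : Z) : sin (2 * PI * IZR k) = 0.
Proof.
  apply sin_eq_0_1. exists (2 * k)%Z. rewrite mult_IZR; ring.
Qed.

Lemma cos_2PI_IZR (k : Z) : cos (2 * PI * IZR k) = 1.
Proof.
  replace (2 * PI * IZR k) with (2 * (PI * IZR k)) by ring.
  rewrite cos_2a_sin. replace (sin (PI * IZR k)) with 0; [ring|].
  symmetry; apply sin_eq_0_1. exists k; ring.
Qed.

Theorem theorem2 :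
  forall (a b : Z) (n : nat) (f : R -> R) (m p : nat),
    (a < b)%Z ->
    (1 < n)%nat ->
    C_n_on (IZR a) (IZR b) n f ->
    (Z.of_nat m <= b - a)%Z ->
    let a' := IZR (a + Z.of_nat m) in
    let fder := Derive_n_on (IZR a) (IZR b) f in
    let M := fun nu : nat => fder nu a' - fder nu (IZR b) in
    let Rmnp := remainder a' (IZR b) n p (fder n) in
    Cmod Rmnp <= T n p * RInt (fun x : R => Rabs (fder n x)) a' (IZR b) /\
    (Nat.Odd n -> monotone_on a' (IZR b) (fder n) ->
       Cmod Rmnp <= 2 * T (n + 1) p * Rabs (M n)) /\
    (Nat.Even n -> monotone_on a' (IZR b) (fder n) ->
       Cmod Rmnp <= T (n + 1) p * Rabs (M n)).
Proof.
  intros a b n f m p Hab Hn [_ Hf] Hm a' fder M Rmnp.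
  assert (Ha' : IZR a <= a') by (apply IZR_le; lia).
  assert (Hb : a' <= IZR b) by (apply IZR_le; lia).
  assert (Hcont : continuous_on (Icc a' (IZR b)) (fder n)).
  { apply (continuous_on_subset_Icc (IZR a) (IZR b)); [exact Ha'|lra|exact Hf]. }
  assert (Hw : Cmod (Ci / Ci ^ n) = 1).
  { unfold Cdiv. rewrite Cmod_mult, Cmod_inv_Ci_pow, Cmod_Ci; ring. }
  assert (Hsin : forall x, Rabs (sin x) <= 1)
    by (intros x; apply Rabs_le, SIN_bound).
  assert (Hcos : forall x, Rabs (cos x) <= 1)
    by (intros x; apply Rabs_le, COS_bound).
  destruct (Nat.Even_or_Odd n) as [He|Ho].
  - assert (H1 := Cmod_remainder_le cos (/ Ci ^ n)%C n p Hn
      (Cmod_inv_Ci_pow n) (fun k x => Zterm_pair_even n k x He)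
      continuous_cos Hcos a' (IZR b) _ Hb Hcont).
    assert (H2 := Cmod_remainder_monotone_le cos sin 1 (/ Ci ^ n)%C n p Hn
      (Cmod_inv_Ci_pow n) (fun k x => Zterm_pair_even n k x He)
      is_derive_sin continuous_cos Hcos Hsin sin_2PI_IZR
      (a + Z.of_nat m) b _ Hb Hcont).
    split; [exact H1|]. split; intros Hpar Hmono.
    + destruct (Nat.Even_Odd_False n He Hpar).
    + rewrite Rmult_1_l in H2. exact (H2 Hmono).
  - assert (H1 := Cmod_remainder_le sin (Ci / Ci ^ n)%C n p Hn
      Hw (fun k x => Zterm_pair_odd n k x Ho)
      continuous_sin Hsin a' (IZR b) _ Hb Hcont).
    assert (H2 := Cmod_remainder_monotone_le sin (fun x => 1 - cos x) 2
      (Ci / Ci ^ n)%C n p Hn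
      Hw (fun k x => Zterm_pair_odd n k x Ho)).
    split; [exact H1|]. split; intros Hpar Hmono.
    + apply H2; auto.
      * intros x. auto_derive; [exact I|ring].
      * apply continuous_sin.
      * intros x. apply Rabs_le. generalize (COS_bound x); lra.
      * intros k. rewrite cos_2PI_IZR; ring.
    + destruct (Nat.Even_Odd_False n Hpar Ho).
Qed.
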